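(* For a nontrivial protoalgebraic logic $\vdash$ the following are equivalent: (i) $\vdash$ has an algebraic semantics; (ii) there are two distinct formulas that are logically equivalent in $\vdash$; (iii) $\mathsf{Alg}(\vdash)$ validates a nontrivial equation; (iv) $\vdash$ has a matrix semantics validating a nontrivial equation; (v) the free Lindenbaum–Tarski algebra $\boldsymbol{Fm}(\vdash)$ is not isomorphic to $\boldsymbol{Fm}$.
   Context: A logic $\vdash$ is a substitution-invariant consequence relation on the set $Fm$ of formulas (over a denumerable set of variables) of a language $\mathscr L_\vdash$; $\boldsymbol{Fm}$ is the formula algebra. $\vdash$ is nontrivial if $x\nvdash y$ for distinct variables. $\vdash$ is protoalgebraic if there is a set of formulas $\Delta(x,y)$ with $\emptyset\vdash\Delta(x,x)$ and $x,\Delta(x,y)\vdash y$. Formulas $\varphi,\psi$ are logically equivalent in $\vdash$ (written $\varphi\equiv_\vdash\psi$) if $\delta(\varphi,\vec z)\dashv\vdash\delta(\psi,\vec z)$ for all formulas $\delta(v,\vec z)$; $\boldsymbol{Fm}(\vdash):=\boldsymbol{Fm}/{\equiv_\vdash}$. An equation $\epsilon\approx\delta$ is nontrivial if $\epsilon\ne\delta$. A matrix is a pair $\langle\boldsymbol A,F\rangle$ with $F\subseteq A$; a class $\mathsf M$ of matrices is a matrix semantics for $\vdash$ if $\Gamma\vdash\varphi$ iff for all $\langle\boldsymbol A,F\rangle\in\mathsf M$ and homomorphisms $h\colon\boldsymbol{Fm}\to\boldsymbol A$, $h[\Gamma]\subseteq F$ implies $h(\varphi)\in F$; it validates an equation if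 all its algebras do. Deductive filters of $\vdash$ on an algebra $\boldsymbol A$ are sets $F\subseteq A$ closed under all rules $\Gamma\vdash\varphi$ under all homomorphisms $\boldsymbol{Fm}\to\boldsymbol A$; $\mathrm{Fg}^{\boldsymbol A}_\vdash(X)$ is the least one containing $X$. $\mathsf{Alg}(\vdash)$ is the class of $\mathscr L_\vdash$-algebras $\boldsymbol A$ such that for distinct $a,c\in A$ there is a unary polynomial function $p$ of $\boldsymbol A$ with $\mathrm{Fg}^{\boldsymbol A}_\vdash(p(a))\ne\mathrm{Fg}^{\boldsymbol A}_\vdash(p(c))$. A logic has an algebraic semantics if there are a set of equations $\boldsymbol\tau(x)$ in one variable and a class $\mathsf K$ of $\mathscr L_\vdash$-algebras such that $\Gamma\vdash\varphi$ iff $\boldsymbol\tau[\Gamma]\vDash_{\mathsf K}\boldsymbol\tau(\varphi)$, where $\boldsymbol\tau[\Gamma]$ collects the instances of $\boldsymbol\tau$ with $x$ replaced by members of $\Gamma$ and $\vDash_{\mathsf K}$ is equational consequence relative to $\mathsf K$. *)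

(* Defs.v *)
From mathcomp Require Import all_boot.
From mathcomp Require Import boolp classical_sets.

Set Implicit Arguments.
Unset Strict Implicit.
Unset Printing Implicit Defensive.

Local Open Scope classical_set_scope.

(** * Algebras and formulas *)

Record language := Language {
  symbol : Type;
  arity : symbol -> nat }.

Record algebra (L : language) := Algebra {
  carrier :> Type;
  carrier_inhabited : inhabited carrier;
  operation : forall f : symbol L, ('I_(arity f) -> carrier) -> carrier }.

Definition is_hom (L : language) (A B : algebra L) (h : A -> B) : Prop :=
  forall (f : symbol L) (a : 'I_(arity f) -> A),
    h (operation a) = operation (fun i => h (a i)).

Definition isomorphic (L : language) (A B : algebra L) : Prop :=
  exists h : A -> B, is_hom h /\ bijective h.

Inductive formula (L : language) : Type :=
| Var of nat
| App (f : symbol L) of ('I_(arity f) -> formula L).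

Arguments Var {L} _.
Arguments App {L} f _.

Definition Fm (L : language) : algebra L :=
  @Algebra L (formula L) (inhabits (Var 0)) (@App L).

Fixpoint occurs (L : language) (x : nat) (t : formula L) : Prop :=
  match t with
  | Var y => x = y
  | App f a => exists i, occurs x (a i)
  end.

Fixpoint eval (L : language) (A : algebra L) (v : nat -> A) (t : formula L) : A :=
  match t with
  | Var x => v x
  | App f a => operation (fun i => eval v (a i))
  end.

Definition upd (T : Type) (v : nat -> T) (x : nat) (a : T) : nat -> T :=
  fun y => if y == x then a else v y.

(* [subst1 x phi d] is the formula d(phi, z), where d = d(x, z). *)
Definition subst1 (L : language) (x : nat) (phi d : formula L) : formula L :=
  @eval L (Fm L) (upd Var x phi) d.

(** * Equations *)

Definition equation (L : language) : Type := (formula L * formula L)%type.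

Definition nontrivial_eq (L : language) (e : equation L) : Prop := e.1 <> e.2.

Definition satisfies (L : language) (A : algebra L) (h : Fm L -> A)
  (e : equation L) : Prop := h e.1 = h e.2.

Definition validates (L : language) (A : algebra L) (e : equation L) : Prop :=
  forall h : Fm L -> A, is_hom h -> satisfies h e.

Definition eq_consequence (L : language) (K : algebra L -> Prop)
    (Theta : set (equation L)) (e : equation L) : Prop :=
  forall A : algebra L, K A -> forall h : Fm L -> A, is_hom h ->
    (forall e', Theta e' -> satisfies h e') -> satisfies h e.

(** * Logics *)

Record logic (L : language) := Logic {
  entails :> set (formula L) -> formula L -> Prop;
  entails_refl : forall (G : set (formula L)) phi, G phi -> entails G phi;
  entails_trans : forall (G D : set (formula L)) phi,
    (forall psi, D psi -> entails G psi) -> entails D phi -> entails G phi;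
  entails_subst : forall (s : Fm L -> Fm L), is_hom s ->
    forall (G : set (formula L)) phi, entails G phi -> entails (s @` G) (s phi) }.

Definition nontrivial (L : language) (l : logic L) : Prop :=
  forall x y : nat, x <> y -> ~ l [set Var x] (Var y).

(* The variables x and y of D(x, y) are 0 and 1. *)
Definition protoalgebraic (L : language) (l : logic L) : Prop :=
  exists D : set (formula L),
    [/\ forall d, D d -> forall z, occurs z d -> z = 0 \/ z = 1,
        forall d, D d -> l set0 (subst1 1 (Var 0) d)
      & l ([set Var 0] `|` D) (Var 1)].

Definition interderivable (L : language) (l : logic L) (phi psi : formula L) :=
  l [set phi] psi /\ l [set psi] phi.

(* The distinguished variable v is quantified over, so that d may have any
   other variable, including those of phi and psi, among its parameters. *)
Definition logically_equivalent (L : language) (l : logic L)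
    (phi psi : formula L) : Prop :=
  forall (v : nat) (d : formula L),
    interderivable l (subst1 v phi d) (subst1 v psi d).

(** * Semantics *)

Record matrix (L : language) := Matrix {
  matrix_alg : algebra L;
  designated : set matrix_alg }.

Definition matrix_semantics (L : language) (l : logic L)
    (M : matrix L -> Prop) : Prop :=
  forall (G : set (formula L)) (phi : formula L),
    l G phi <->
    (forall m : matrix L, M m ->
       forall h : Fm L -> matrix_alg m, is_hom h ->
         h @` G `<=` designated (m := m) -> designated (h phi)).

Definition deductive_filter (L : language) (l : logic L) (A : algebra L)
    (F : set A) : Prop :=
  forall (G : set (formula L)) (phi : formula L), l G phi ->
    forall h : Fm L -> A, is_hom h -> h @` G `<=` F -> F (h phi).

Definition Fg (L : language) (l : logic L) (A : algebra L) (X : set A) : set A :=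
  smallest (@deductive_filter L l A) X.

Definition unary_polynomial (L : language) (A : algebra L) (p : A -> A) : Prop :=
  exists (t : formula L) (x : nat) (v : nat -> A),
    forall a, p a = eval (upd v x a) t.

Definition Alg (L : language) (l : logic L) (A : algebra L) : Prop :=
  forall a c : A, a <> c ->
    exists2 p : A -> A, unary_polynomial p & Fg l [set p a] <> Fg l [set p c].

(* The variable x of tau(x) is 0. *)
Definition eq_inst (L : language) (phi : formula L) (e : equation L) : equation L :=
  (subst1 0 phi e.1, subst1 0 phi e.2).

Definition has_algebraic_semantics (L : language) (l : logic L) : Prop :=
  exists (tau : set (equation L)) (K : algebra L -> Prop),
    (forall e, tau e -> forall z, occurs z e.1 \/ occurs z e.2 -> z = 0) /\
    (forall (G : set (formula L)) (phi : formula L),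
       l G phi <->
       (forall e, tau e ->
          eq_consequence K (\bigcup_(g in G) (eq_inst g @` tau)) (eq_inst phi e))).

(** * Quotients and the free Lindenbaum-Tarski algebra *)

Record congruence (L : language) (A : algebra L) := Congruence {
  crel :> A -> A -> Prop;
  crel_refl : forall a, crel a a;
  crel_sym : forall a b, crel a b -> crel b a;
  crel_trans : forall a b c, crel a b -> crel b c -> crel a c;
  crel_op : forall (f : symbol L) (a b : 'I_(arity f) -> A),
    (forall i, crel (a i) (b i)) -> crel (operation a) (operation b) }.

Section Quotient.
Variables (L : language) (A : algebra L) (R : congruence A).

Definition quot : Type := {X : set A | exists a, X = [set b | R a b]}.

Definition quot_class (a : A) : quot :=
  exist _ [set b | R a b] (ex_intro _ a erefl).

Definition quot_repr (X : quot) : A := projT1 (cid (proj2_sig X)).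

Lemma quot_inhabited : inhabited quot.
Proof. by case: (carrier_inhabited A) => a; exists; exact: (quot_class a). Qed.

Definition quot_alg : algebra L :=
  @Algebra L quot quot_inhabited
    (fun f X => quot_class (operation (fun i => quot_repr (X i)))).

Lemma quot_classP (a b : A) : quot_class a = quot_class b <-> R a b.
Proof.
split=> [/(congr1 (@proj1_sig _ _)) /= E|Rab].
  by have : [set c | R b c] b by [exact: crel_refl]; rewrite -E.
have E : [set c | R a c] = [set c | R b c].
  apply/seteqP; split=> c /=; apply: crel_trans => //; exact: crel_sym.
rewrite /quot_class; move: (ex_intro _ a _) (ex_intro _ b _).
by rewrite E => p q; congr exist; exact: Prop_irrelevance.
Qed.

Lemma quot_reprK (X : quot) : quot_class (quot_repr X) = X.
Proof.
rewrite /quot_repr; case: cid => a /= E; case: X E => X p /= E.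
by subst X; congr exist; exact: Prop_irrelevance.
Qed.

Lemma quot_class_hom : @is_hom L A quot_alg quot_class.
Proof.
move=> f a; apply/quot_classP; apply: crel_op => i.
by apply/quot_classP; rewrite quot_reprK.
Qed.

End Quotient.

Section LogicalEquivalence.
Variables (L : language) (l : logic L).

Lemma eval_ext (A : algebra L) (v w : nat -> A) (t : formula L) :
  (forall x, occurs x t -> v x = w x) -> eval v t = eval w t.
Proof.
elim: t => [x|f a IH] /= vw; first exact: vw.
by congr operation; apply: funext => i; apply: IH => x xi; apply: vw; exists i.
Qed.

Lemma eval_subst (s : nat -> formula L) (A : algebra L) (v : nat -> A) t :
  eval v (@eval L (Fm L) s t) = eval (fun x => eval v (s x)) t.
Proof.
by elim: t => [//|f a IH] /=; congr operation; apply: funext => i; exact: IH.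
Qed.

Lemma eval_Var (t : formula L) : @eval L (Fm L) Var t = t.
Proof. by elim: t => [//|f a IH] /=; congr App; apply: funext. Qed.

Lemma occurs_bound (t : formula L) : exists n, forall x, occurs x t -> x < n.
Proof.
elim: t => [y|f a IH] /=; first by exists y.+1 => x ->.
have [n Hn] := choice IH.
exists (\max_i n i) => x [i /Hn xi].
exact: leq_trans xi (leq_bigmax i).
Qed.

Lemma logically_equivalent_refl phi : logically_equivalent l phi phi.
Proof. by move=> v d; split; apply: entails_refl. Qed.

Lemma logically_equivalent_sym phi psi :
  logically_equivalent l phi psi -> logically_equivalent l psi phi.
Proof. by move=> H v d; have [] := H v d. Qed.

Lemma entails1_trans phi psi chi :
  l [set phi] psi -> l [set psi] chi -> l [set phi] chi.
Proof. by move=> H; apply: entails_trans => _ ->. Qed.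

Lemma logically_equivalent_trans phi psi chi :
  logically_equivalent l phi psi -> logically_equivalent l psi chi ->
  logically_equivalent l phi chi.
Proof.
move=> H K v d; have [H1 H2] := H v d; have [K1 K2] := K v d.
by split; [exact: entails1_trans H1 K1|exact: entails1_trans K2 H2].
Qed.

Lemma logically_equivalent_ctx phi psi x t :
  logically_equivalent l phi psi ->
  logically_equivalent l (subst1 x phi t) (subst1 x psi t).
Proof.
move=> H v d.
have [m Hm] := occurs_bound d; have [n Hn] := occurs_bound t.
pose w := maxn m n; pose t' := subst1 x (Var w) t.
have E chi : subst1 v (subst1 x chi t) d = subst1 w chi (subst1 v t' d).
  rewrite /subst1 [RHS]eval_subst; apply: (@eval_ext (Fm L)) => y /Hm ym.
  rewrite /upd; case: eqP => _ /=.
    rewrite /t' /subst1 [RHS]eval_subst; apply: (@eval_ext (Fm L)) => z /Hn zn.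
    rewrite /upd; case: eqP => _ /=; first by rewrite eqxx.
    by rewrite ltn_eqF // (leq_trans zn) // leq_maxr.
  by rewrite ltn_eqF // (leq_trans ym) // leq_maxl.
by rewrite (E phi) (E psi); exact: H.
Qed.

Lemma logically_equivalent_op (f : symbol L) (a b : 'I_(arity f) -> Fm L) :
  (forall i, logically_equivalent l (a i) (b i)) ->
  logically_equivalent l (operation a) (operation b).
Proof.
move=> H; pose mix k (i : 'I_(arity f)) : formula L := if i < k then b i else a i.
suff S k : k <= arity f -> logically_equivalent l (App f a) (App f (mix k)).
  rewrite /= (_ : b = mix (arity f)); first exact: S.
  by apply: funext => i; rewrite /mix ltn_ord.
elim: k => [_|k IH kn].
  rewrite (_ : mix 0 = a); first exact: logically_equivalent_refl.
  exact: funext.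
apply: logically_equivalent_trans (IH (ltnW kn)) _.
have [n Hn] : exists n, forall i x, occurs x (mix k i) -> x < n.
  have [n Hn] := occurs_bound (App f (mix k)).
  by exists n => i x xi; apply: Hn; exists i.
pose i0 := Ordinal kn.
pose t := App f (fun i => if i == i0 then Var n else mix k i).
have E chi : App f (fun i => if i == i0 then chi else mix k i) = subst1 n chi t.
  rewrite /subst1 /=; congr App; apply: funext => i; case: eqP => _ /=.
    by rewrite /upd eqxx.
  rewrite -[LHS]eval_Var; apply: (@eval_ext (Fm L)) => x /Hn xn.
  by rewrite /upd ltn_eqF.
have -> : mix k = (fun i => if i == i0 then a i0 else mix k i).
  by apply: funext => i; case: eqP => // ->; rewrite /mix ltnn.
have -> : mix k.+1 = (fun i => if i == i0 then b i0 else mix k i).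
  apply: funext => i; case: eqP => [->|/eqP ni]; first by rewrite /mix ltnSn.
  by rewrite /mix ltnS leq_eqVlt (negbTE (_ : i != k :> nat)).
by rewrite (E (a i0)) (E (b i0)); exact: logically_equivalent_ctx.
Qed.

Definition logical_congruence : congruence (Fm L) :=
  @Congruence L (Fm L) (logically_equivalent l) logically_equivalent_refl
    logically_equivalent_sym logically_equivalent_trans
    logically_equivalent_op.

Definition FmLT : algebra L := quot_alg logical_congruence.

End LogicalEquivalence.

(* Main.v *)
Require Import Defs.
From mathcomp Require Import all_boot.
From mathcomp Require Import boolp classical_sets.
From mathcomp Require Import zify.

(** Conditions (ii)-(v) are linked through the algebra [FmLT l], which lies in
    [Alg l], carries the theories of [l] as filters, and satisfies exactly the
    logical equivalences.

    (i) => (ii): a nontrivial protoalgebraic logic has theorems [t] with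
    variables, hence arbitrarily deep ones.  If [e = d] is a nontrivial equation
    of tau, then [e(t)] and [d(t)] are distinct when [t] is deep enough, and they
    are equal in the semantics because [t] is a theorem.

    (ii) => (i): protoalgebraicity also provides a symbol [f] of arity at least
    two.  Distinct equivalent formulas can be turned into one-variable ones, phi
    and psi, that stay distinct under every instantiation, and then into
    [eps = f(f(phi, g), g')] and [delta = f(f(psi, g), g')] where the padding
    [g(x)], [g'(x)] is so deep that no instance of delta overlaps an instance of
    eps or of a proper nonvariable subformula of eps or delta.  For a theory T,
    let the operations of the formula algebra rewrite a result [delta(r)] with
    [r] in T to [eps(r)].  Up to logical equivalence nothing has changed, but now
    [r] solves [eps = delta] iff [r] is in T. *)

Set Implicit Arguments.
Unset Strict Implicit.
Unset Printing Implicit Defensive.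

Local Open Scope classical_set_scope.

(** * Formulas *)

Section Formulas.
Variable L : language.
Implicit Types (t u : formula L) (s : nat -> formula L).

Notation subst := (@eval L (Fm L)).

Lemma hom_eval (A : algebra L) (h : Fm L -> A) :
  is_hom h -> forall t, h t = eval (fun x => h (Var x)) t.
Proof.
move=> hh; elim=> [//|f a IH] /=; rewrite (hh f a); congr operation.
exact: funext.
Qed.

Lemma eval_hom (A : algebra L) (v : nat -> A) : @is_hom L (Fm L) A (eval v).
Proof. by []. Qed.

Lemma eval_subst1 (A : algebra L) (v : nat -> A) x u t :
  eval v (subst1 x u t) = eval (upd v x (eval v u)) t.
Proof.
rewrite /subst1 eval_subst; apply: eval_ext => y _.
by rewrite /upd; case: eqP.
Qed.

Lemma occurs_subst s t z :
  occurs z (subst s t) -> exists2 y, occurs y t & occurs z (s y).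
Proof.
elim: t => [y|f a IH] /=; first by exists y.
by case=> i /IH[y yi zy]; exists y => //; exists i.
Qed.

Lemma subst_occurs s t y z :
  occurs y t -> occurs z (s y) -> occurs z (subst s t).
Proof.
elim: t => [x /= <- //|f a IH] /= [i yi] zy.
by exists i; apply: IH.
Qed.

Lemma subst_closed s t : (forall x, ~ occurs x t) -> subst s t = t.
Proof.
move=> H; rewrite -[RHS]eval_Var.
by apply: (@eval_ext L (Fm L)) => x /H.
Qed.

Definition head t : option (symbol L) := if t is App f _ then Some f else None.

Definition child t (k : nat) : formula L :=
  if t is App f a then oapp a t (insub k) else t.

Lemma App_inj (f : symbol L) (a b : 'I_(arity f) -> formula L) :
  App f a = App f b -> a = b.
Proof.
move=> E; apply: funext => i; move/(congr1 (fun t => child t i)): E.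
by rewrite /= valK.
Qed.

Fixpoint depth t : nat :=
  match t with
  | Var _ => 0
  | App f a => (\max_i depth (a i)).+1
  end.

Lemma depth_arg (f : symbol L) (a : 'I_(arity f) -> formula L) i :
  depth (a i) < depth (App f a).
Proof. by rewrite /= ltnS (leq_bigmax (F := fun i => depth (a i))). Qed.

Lemma depth_subst_occurs s t x :
  occurs x t -> depth (s x) <= depth (subst s t).
Proof.
elim: t => [y /= -> //|f a IH] [i /IH xi].
apply: leq_trans xi (ltnW _).
exact: (@depth_arg f (fun i => subst s (a i))).
Qed.

Lemma depth_subst_App s (f : symbol L) (a : 'I_(arity f) -> formula L) x :
  occurs x (App f a) -> depth (s x) < depth (subst s (App f a)).
Proof.
case=> i /(depth_subst_occurs s) xi.
exact: leq_ltn_trans xi (@depth_arg f (fun i => subst s (a i)) i).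
Qed.

Lemma depth_subst_le s t k :
  (forall x, depth (s x) <= k) -> depth (subst s t) <= depth t + k.
Proof.
move=> sk; elim: t => [x|f a IH]; first exact: sk.
rewrite /= addSn ltnS; apply/bigmax_leqP => i _.
apply: leq_trans (IH i) _.
by rewrite leq_add2r (leq_bigmax (F := fun i => depth (a i))).
Qed.

(* Substitutes deeper than both formulas cannot be mistaken for instances of
   their nonvariable subformulas; so equal images force equal formulas as soon
   as, for each i, a substitution is available that isolates the variable i. *)
Lemma deep_subst_inj (V : set nat) (S : nat -> set (nat -> formula L)) (N : nat) :
  (forall i s, V i -> S i s -> N < depth (s i)) ->
  (forall i s j, V i -> S i s -> depth (s i) <= depth (s j)) ->
  (forall i s j, V i -> V j -> S i s -> s j = s i -> j = i) ->
  forall t u, depth t <= N -> depth u <= N ->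
  (forall x, occurs x t -> V x) -> (forall x, occurs x u -> V x) ->
  (forall i, exists2 s, S i s & subst s t = subst s u) -> t = u.
Proof.
move=> deep low sep.
(* If [App f a] has a variable, its instance is deeper than some [s x], hence than [s i]; if it is
   closed, its instance is itself, of depth at most [N]. *)
have VA i s f a : V i -> S i s -> depth (App f a) <= N ->
    s i <> subst s (App f a).
  move=> Vi Ss aN E.
  have [[x xa]|ncl] := pselect (exists x, occurs x (App f a)).
    have := depth_subst_App s xa; rewrite -E ltnNge.
    by rewrite (low _ _ _ Vi Ss).
  have := deep _ _ Vi Ss; rewrite E subst_closed; first by rewrite ltnNge aN.
  by move=> x xa; apply: ncl; exists x.
elim=> [i|f a IH] [j|g b] tN uN Vt Vu H.
- have [s Ss E] := H i; congr Var; apply/esym.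
  by apply: (sep i s j) => //; [exact: Vt|exact: Vu].
- have [s Ss E] := H i; exfalso; apply: (VA i s g b) => //; exact: Vt.
- have [s Ss E] := H j; exfalso; apply: (VA j s f a) => //; exact: Vu.
have fg : f = g by have [s _ /(congr1 head) [] ] := H 0.
subst g; congr App; apply: funext => k.
apply: IH.
- exact: leq_trans (ltnW (depth_arg a k)) tN.
- exact: leq_trans (ltnW (depth_arg b k)) uN.
- by move=> x xk; apply: Vt; exists k.
- by move=> x xk; apply: Vu; exists k.
move=> i; have [s Ss E] := H i; exists s => //.
exact: (congr1 (fun c => c k) (App_inj E)).
Qed.

(** * Padding terms over a symbol of arity at least two *)

Section Binary.
Variables (f : symbol L) (f2 : 1 < arity f).

Definition bin u v : formula L :=
  App f (fun i => if i == 0 :> nat then u else v).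

Arguments bin : simpl never.

Lemma bin_inj u v u' v' : bin u v = bin u' v' -> u = u' /\ v = v'.
Proof.
move=> /App_inj E; split.
  exact: (congr1 (fun c => c (Ordinal (ltnW f2))) E).
exact: (congr1 (fun c => c (Ordinal f2)) E).
Qed.

Lemma depth_bin u v : depth (bin u v) = (maxn (depth u) (depth v)).+1.
Proof.
apply/eqP; rewrite eqn_leq; apply/andP; split.
  rewrite /= ltnS; apply/bigmax_leqP => i _.
  by case: ifP => _; rewrite ?leq_maxl ?leq_maxr.
rewrite gtn_max; apply/andP; split.
  exact: (@depth_arg f (fun i => if i == 0 :> nat then u else v)
    (Ordinal (ltnW f2))).
exact: (@depth_arg f (fun i => if i == 0 :> nat then u else v) (Ordinal f2)).
Qed.

Lemma subst_bin s u v : subst s (bin u v) = bin (subst s u) (subst s v).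
Proof. by rewrite /bin /=; congr App; apply: funext => i; case: ifP. Qed.

Lemma occurs_bin u v z : occurs z (bin u v) -> occurs z u \/ occurs z v.
Proof. by case=> i; case: ifP; [left|right]. Qed.

Definition tower n t : formula L := iter n (fun u => bin u u) t.

Arguments tower : simpl never.

Lemma towerS n t : tower n.+1 t = bin (tower n t) (tower n t).
Proof. by []. Qed.

Lemma depth_tower n t : depth (tower n t) = n + depth t.
Proof. by elim: n => // n IH; rewrite towerS depth_bin maxnn IH. Qed.

Lemma subst_tower s n t : subst s (tower n t) = tower n (subst s t).
Proof. by elim: n => // n IH; rewrite !towerS subst_bin IH. Qed.

Lemma occurs_tower n t z : occurs z (tower n t) -> occurs z t.
Proof. by elim: n => // n IH; rewrite towerS => /occurs_bin[]. Qed.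

Lemma tower_inj n t u : tower n t = tower n u -> t = u.
Proof. by elim: n => // n IH; rewrite !towerS => /bin_inj[] /IH. Qed.

End Binary.

(** Descending while both variables lie in the same argument, one reaches a node where they sit in
    two different positions. *)
Lemma two_variables_arity t x y :
  x <> y -> occurs x t -> occurs y t -> exists f : symbol L, 1 < arity f.
Proof.
move=> xy; elim: t => [z /= xz yz|f a IH [i xi] [j yj]].
  by case: xy; rewrite xz.
have [ij|ij] := eqVneq i j; first by subst j; exact: (IH i).
by exists f; move: i j {xi yj} ij => [i iP] [j jP] /eqP/= ij;
  case: (ltnP 1 (arity f)) => // a1; case: ij; apply: val_inj => /=; lia.
Qed.

Lemma one_variable_instance (f : symbol L) (f2 : 1 < arity f) t u : t <> u ->
  exists s, (forall x z, occurs z (s x) -> z = 0) /\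
    (forall r, subst (fun=> r) (subst s t) <> subst (fun=> r) (subst s u)).
Proof.
move=> tu; pose N := (maxn (depth t) (depth u)).+1.
pose q r := bin f r (tower f N r); pose q' r := bin f (tower f N r) r.
pose s (i : nat) r (x : nat) := if x == i then q r else q' r.
have dq r : depth (q r) = (N + depth r).+1.
  by rewrite /q depth_bin // depth_tower //; lia.
have dq' r : depth (q' r) = (N + depth r).+1.
  by rewrite /q' depth_bin // depth_tower //; lia.
have ds i r x : depth (s i r x) = (N + depth r).+1.
  by rewrite /s; case: ifP.
have ss i r w : subst (fun=> r) (subst (s i (Var 0)) w) = subst (s i r) w.
  rewrite [LHS]eval_subst; congr (subst _ w); apply: funext => x.
  by rewrite /s; case: ifP => _;
    rewrite [LHS](@subst_bin f (fun=> r)) ?(@subst_tower f (fun=> r)).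
suff [i Hi] : exists i, forall r, subst (s i r) t <> subst (s i r) u.
  exists (s i (Var 0)); split=> [x z|r]; last by rewrite !ss; exact: Hi.
  by rewrite /s; case: ifP => _ /occurs_bin[] => [|/occurs_tower|/occurs_tower|].
apply: contrapT => H; apply: tu.
apply: (@deep_subst_inj setT (fun i => range (s i)) N).
- by move=> i _ _ [r _ <-]; rewrite ds; lia.
- by move=> i _ j _ [r _ <-]; rewrite !ds.
- move=> i _ j _ _ [r _ <-]; rewrite /s eqxx; case: eqP => // _.
  move=> /bin_inj[] // /(congr1 depth); rewrite depth_tower //; lia.
- by rewrite /N; lia.
- by rewrite /N; lia.
- by [].
- by [].
move=> i; apply: contrapT => K; apply: H; exists i => r E; apply: K.
by exists (s i r) => //; exists r.
Qed.

End Formulas.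

Arguments bin : simpl never.
Arguments tower : simpl never.

Notation subst := (@eval _ (Fm _)).

(** * Logical equivalence *)

Section LogicalEquivalence.
Variables (L : language) (l : logic L).
Implicit Types (t u phi psi d : formula L).

Lemma entails_inst (G : set (formula L)) phi (s : nat -> formula L) :
  l G phi -> l (subst s @` G) (subst s phi).
Proof. exact/entails_subst/eval_hom. Qed.

Lemma entails_inst1 t u (s : nat -> formula L) :
  l [set t] u -> l [set subst s t] (subst s u).
Proof.
move/(entails_inst s); apply: entails_trans => _ [_ -> <-].
exact: entails_refl.
Qed.

Lemma theorem_inst phi (s : nat -> formula L) :
  l set0 phi -> l set0 (subst s phi).
Proof. by move/(entails_inst s); rewrite image_set0. Qed.

(* The parameters of d are renamed away from the variables of phi and psi, so
   that the two valuations w and v can be merged into one. *)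
Lemma polynomial_context (A : algebra L) phi psi (w v : nat -> A) x d :
  exists n d' (z : nat -> A),
    eval (upd v x (eval w phi)) d = eval z (subst1 n phi d') /\
    eval (upd v x (eval w psi)) d = eval z (subst1 n psi d').
Proof.
have [m Hm] := occurs_bound phi; have [k Hk] := occurs_bound psi.
pose n := maxn m k.
(* Index [n] is reserved for the hole of the context: [w] lives below it, and [v], shifted by
   [n.+1], above it. *)
pose z y := if y < n then w y else v (y - n.+1).
pose d' := subst (fun y => if y == x then Var n else Var (n.+1 + y)) d.
have E chi : (forall y, occurs y chi -> y < n) ->
    eval (upd v x (eval w chi)) d = eval z (subst1 n chi d').
  move=> Hn; rewrite eval_subst1 /d' eval_subst; apply: eval_ext => y _.
  rewrite /upd; case: eqP => _ /=.
    by rewrite eqxx; apply: eval_ext => j /Hn jn; rewrite /z jn.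
  rewrite gtn_eqF; last by lia.
  have -> : z (n.+1 + y) = v (n.+1 + y - n.+1) by rewrite /z ifF //; lia.
  by rewrite addKn.
exists n, d', z; split; [apply: E => y /Hm|apply: E => y /Hk]; rewrite /n; lia.
Qed.

(** A context around the substituted formulas is a substitution instance of a context around the
    original ones, and [l] is substitution-invariant. *)
Lemma logically_equivalent_subst phi psi (s : nat -> formula L) :
  logically_equivalent l phi psi ->
  logically_equivalent l (subst s phi) (subst s psi).
Proof.
move=> H x d; rewrite /subst1.
have [n [d' [z [-> ->]]]] := @polynomial_context (Fm L) phi psi s Var x d.
by have [H1 H2] := H n d'; split; apply: entails_inst1.
Qed.

Lemma logically_equivalent_entails phi psi :
  logically_equivalent l phi psi -> l [set phi] psi.
Proof. by move=> H; have [] := H 0 (Var 0). Qed.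

Definition theory (T : set (formula L)) : Prop := forall phi, l T phi -> T phi.

Definition Th (G : set (formula L)) : set (formula L) := [set phi | l G phi].

Lemma theory_Th G : theory (Th G).
Proof. by move=> phi; apply: entails_trans. Qed.

Lemma theory_equiv T phi psi :
  theory T -> logically_equivalent l phi psi -> T phi -> T psi.
Proof.
move=> TT /logically_equivalent_entails H Tphi; apply: TT.
by apply: entails_trans H => _ ->; exact: entails_refl.
Qed.

(** By [polynomial_context], a polynomial separating the two values comes from a formula context, in
    which [phi] and [psi] are interderivable and so generate the same filter. *)
Lemma Alg_validates phi psi : logically_equivalent l phi psi ->
  forall A : algebra L, Alg l A -> validates A (phi, psi).
Proof.
move=> H A AA h hh; rewrite /satisfies /=; apply: contrapT => hne.
have [p [d [x [v pE]]]] := AA _ _ hne; apply.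
have [n [d' [z [E1 E2]]]] :=
  polynomial_context phi psi (fun x => h (Var x)) v x d.
rewrite -!hom_eval // in E1 E2.
rewrite !pE E1 E2; have [H1 H2] := H n d'.
have sub t u : l [set t] u -> Fg l [set eval z u] `<=` Fg l [set eval z t].
  move=> tu a Fa F [FF Ft]; apply: Fa; split=> // _ ->.
  apply: (FF _ _ tu _ (eval_hom z)) => _ [_ -> <-]; exact: Ft.
by apply/seteqP; split; apply: sub.
Qed.

(** * Filters and matrices on the Lindenbaum-Tarski algebra *)

Let cls : Fm L -> FmLT l := @quot_class L (Fm L) (logical_congruence l).
Let rep : FmLT l -> Fm L := @quot_repr L (Fm L) (logical_congruence l).

Let cls_hom : is_hom cls.
Proof. exact: quot_class_hom. Qed.

Lemma eval_FmLT (v : nat -> FmLT l) t : eval v t = cls (subst (rep \o v) t).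
Proof.
rewrite (hom_eval cls_hom) eval_subst; apply: eval_ext => x _ /=.
by rewrite -(hom_eval cls_hom) /cls /rep quot_reprK.
Qed.

(** Choosing representatives lifts a homomorphism into [FmLT l] to a substitution, and a theory is a
    union of equivalence classes. *)
Lemma FmLT_filter T :
  theory T -> @deductive_filter L l (FmLT l) (cls @` T).
Proof.
move=> TT G phi Gphi h hh hG.
have hE t : h t = cls (subst (rep \o (fun x => h (Var x))) t).
  by rewrite (hom_eval hh) eval_FmLT.
rewrite hE; eexists; last reflexivity; apply: (TT _).
apply: entails_trans (entails_inst _ Gphi) => _ [g Gg <-].
have /hG : (h @` G) (h g) by exists g.
case=> t Tt; rewrite hE => /quot_classP E.
by apply: entails_refl; exact: theory_equiv TT E Tt.
Qed.

Lemma cls_theory T t : theory T -> (cls @` T) (cls t) -> T t.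
Proof. by move=> TT [u Tu /quot_classP E]; exact: theory_equiv TT E Tu. Qed.

Lemma Alg_FmLT : Alg l (FmLT l).
Proof.
move=> a c; rewrite -(quot_reprK a) -(quot_reprK c).
move: (quot_repr a) (quot_repr c) => phi psi; rewrite -/(cls phi) -/(cls psi) => ne.
have [x [d H]] : exists x d,
    ~ interderivable l (subst1 x phi d) (subst1 x psi d).
  apply: contrapT => H; apply: ne; apply/quot_classP => x d.
  by apply: contrapT => K; apply: H; exists x, d.
pose v : nat -> FmLT l := fun y => cls (Var y).
exists (fun a => eval (upd v x a) d); first by exists d, x, v.
have E t : eval (upd v x (cls t)) d = cls (subst1 x t d).
  rewrite [RHS](hom_eval cls_hom) eval_subst1; apply: eval_ext => y _.
  by rewrite -(hom_eval cls_hom).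
rewrite !E => F; apply: H.
have sub t u : Fg l [set cls u] `<=` Fg l [set cls t] -> l [set t] u.
  move=> H; have : Fg l [set cls t] (cls u).
    by apply: H => G [_]; apply.
  (* The filter of the theory generated by [t] turns membership back into derivability. *)
  move/(_ (cls @` Th [set t])) => /= /(_ _)/(cls_theory (@theory_Th _)); apply.
  split; first exact/FmLT_filter/theory_Th.
  by move=> _ ->; exists t => //; exact: entails_refl.
by split; apply: sub; rewrite F.
Qed.

Lemma FmLT_semantics : matrix_semantics l
  (fun m => matrix_alg m = FmLT l /\ deductive_filter l (designated (m := m))).
Proof.
move=> G phi; split=> [Gphi m [_ mF] h hh|H]; first exact: mF.
apply: (cls_theory (@theory_Th G)).
apply: (H (@Matrix L (FmLT l) (cls @` Th G))) => //=.
  by split=> //; exact/FmLT_filter/theory_Th.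
by move=> _ [t Gt <-]; exists t => //; exact: entails_refl.
Qed.

Lemma matrix_semantics_equiv (M : matrix L -> Prop) phi psi :
  matrix_semantics l M ->
  (forall m, M m -> validates (matrix_alg m) (phi, psi)) ->
  logically_equivalent l phi psi.
Proof.
move=> MS MV x d.
have E m (h : Fm L -> matrix_alg m) : M m -> is_hom h ->
    h (subst1 x phi d) = h (subst1 x psi d).
  move=> Mm hh; have := MV m Mm h hh.
  rewrite /satisfies /= !(hom_eval hh (subst1 _ _ _)) !eval_subst1.
  by rewrite -!(hom_eval hh) => ->.
split; apply/MS => m Mm h hh H.
  by rewrite -E //; apply: H; exists (subst1 x phi d).
by rewrite E //; apply: H; exists (subst1 x psi d).
Qed.

(** An isomorphism onto [Fm L] yields a homomorphism [k] with left inverse [h]; but [k] identifies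
    [phi] and [psi], since [FmLT l] lies in [Alg l]. *)
Lemma FmLT_not_isomorphic phi psi :
  phi <> psi -> logically_equivalent l phi psi -> ~ isomorphic (FmLT l) (Fm L).
Proof.
move=> ne H [h [hh [g gK hK]]]; apply: ne.
pose k := eval (g \o Var) : Fm L -> FmLT l.
have hk t : h (k t) = t.
  by elim: t => [x|f a IH] /=; rewrite ?hK // hh /=; congr App; exact: funext.
rewrite -(hk phi) -(hk psi); congr h.
exact: (Alg_validates H Alg_FmLT (eval_hom _)).
Qed.

Lemma FmLT_isomorphic :
  (forall phi psi, logically_equivalent l phi psi -> phi = psi) ->
  isomorphic (FmLT l) (Fm L).
Proof.
move=> H; exists rep; split.
  move=> f a; apply: H; apply/(quot_classP (logical_congruence l)).
  by rewrite /rep quot_reprK.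
exists cls; first by move=> a; exact: quot_reprK.
move=> t; apply: H; apply/(quot_classP (logical_congruence l)).
by rewrite /rep quot_reprK.
Qed.

End LogicalEquivalence.

(** * Protoalgebraic logics *)

Section Protoalgebraic.
Variables (L : language) (l : logic L).
Hypotheses (l_nontrivial : nontrivial l) (l_protoalgebraic : protoalgebraic l).

(** If [D] consisted of theorems, modus ponens would give [x |- y]. A non-theorem of [D] lacking one
    of its two variables would be an instance of the theorem [d(x,x)]. *)
Lemma protoalgebraic_formula : exists d : formula L,
  [/\ occurs 0 d, occurs 1 d & l set0 (subst1 1 (Var 0) d)].
Proof.
have [D [Dvar Dthm Dmp]] := l_protoalgebraic.
have [d Dd nd] : exists2 d, D d & ~ l set0 d.
  apply: contrapT => H; apply: (@l_nontrivial 0 1) => //.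
  apply: entails_trans Dmp => d [->|Dd]; first exact: entails_refl.
  apply: (@entails_trans _ _ _ set0) => //.
  by apply: contrapT => nd; apply: H; exists d.
exists d; split; last exact: Dthm.
  apply: contrapT => n0; apply: nd.
  have := theorem_inst (fun=> Var 1) (Dthm _ Dd).
  rewrite eval_subst1 (_ : subst _ d = d) //.
  rewrite -[RHS]eval_Var; apply: (@eval_ext L (Fm L)) => x xd.
  by have [x0|->] := Dvar _ Dd _ xd; rewrite /upd ?eqxx //; subst x.
apply: contrapT => n1; apply: nd.
have := Dthm _ Dd; rewrite /subst1 (_ : subst _ d = d) //.
rewrite -[RHS]eval_Var; apply: (@eval_ext L (Fm L)) => x xd.
by rewrite /upd; case: eqP => // x1; subst x.
Qed.

Lemma protoalgebraic_arity : exists f : symbol L, 1 < arity f.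
Proof.
have [d [d0 d1 _]] := protoalgebraic_formula.
exact: two_variables_arity d0 d1.
Qed.

Lemma deep_theorem n : exists2 t, n <= depth t & l set0 t.
Proof.
have [d [d0 _ dthm]] := protoalgebraic_formula.
have [f f2] := protoalgebraic_arity.
exists (subst (fun=> tower f n (Var 0)) (subst1 1 (Var 0) d)); last first.
  exact: theorem_inst.
apply: (@leq_trans (depth (tower f n (@Var L 0)))).
  by rewrite depth_tower // addn0.
apply: (depth_subst_occurs (fun=> tower f n (Var 0)) (x := 0)).
by apply: subst_occurs d0 _.
Qed.

Lemma algebraic_semantics_equiv : has_algebraic_semantics l ->
  exists phi psi : formula L, phi <> psi /\ logically_equivalent l phi psi.
Proof.
move=> [tau [K [tau0 tauP]]].
(* If all equations of [tau] were trivial, every formula would entail every other. *)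
have [[e d] te ed] : exists2 e, tau e & e.1 <> e.2.
  apply: contrapT => H; apply: (@l_nontrivial 0 1) => //; apply/tauP.
  move=> [e d] te A _ h _ _; rewrite /satisfies /eq_inst /=; congr (h (subst1 _ _ _)).
  by apply: contrapT => ne; apply: H; exists (e, d).
rewrite /= in ed.
have [t td tthm] := deep_theorem (maxn (depth e) (depth d)).+1.
exists (subst1 0 t e), (subst1 0 t d); split.
  have Ec u : (forall z, occurs z u -> z = 0) -> subst1 0 t u = subst (fun=> t) u.
    by move=> H; apply: (@eval_ext L (Fm L)) => x /H ->.
  rewrite !Ec; last 2 first.
    by move=> z zo; apply: (tau0 _ te); right.
    by move=> z zo; apply: (tau0 _ te); left.
  move=> E; apply: ed.
  apply: (@deep_subst_inj L [set 0] (fun=> [set (fun=> t)])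
    (maxn (depth e) (depth d))).
  - by move=> i s _ ->.
  - by move=> i s j _ ->.
  - by move=> i s j -> ->.
  - exact: leq_maxl.
  - exact: leq_maxr.
  - by move=> z zo; apply: (tau0 _ te); left.
  - by move=> z zo; apply: (tau0 _ te); right.
  by move=> _; exists (fun=> t).
have KE (A : algebra L) (h : Fm L -> A) :
    K A -> is_hom h -> h (subst1 0 t e) = h (subst1 0 t d).
  move=> KA hh.
  have := (tauP _ _).1 tthm _ te A KA h hh; apply.
  by move=> e' [].
move: (subst1 0 t e) (subst1 0 t d) KE => phi psi KE {t td tthm e d te ed} x c.
have KC (A : algebra L) (h : Fm L -> A) :
    K A -> is_hom h -> h (subst1 x phi c) = h (subst1 x psi c).
  move=> KA hh; rewrite !(hom_eval hh (subst1 _ _ _)) !eval_subst1.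
  by rewrite -!(hom_eval hh) KE.
(* Formulas equal throughout [K] satisfy the same instances of [tau]. *)
have KI a b :
    (forall (A : algebra L) (h : Fm L -> A), K A -> is_hom h -> h a = h b) ->
    l [set a] b.
  move=> ab; apply/tauP => e te A KA h hh H.
  have /H : (\bigcup_(g in [set a]) (eq_inst g @` tau)) (eq_inst a e).
    by exists a => //; exists e.
  rewrite /satisfies /= !(hom_eval hh (subst1 _ _ _)) !eval_subst1.
  by rewrite -!(hom_eval hh) ab.
by split; apply: KI => A h KA hh; rewrite KC.
Qed.

End Protoalgebraic.

(** * Rewriting the formula algebra *)

Section RewrittenAlgebra.
Variables (L : language) (l : logic L) (f : symbol L) (f2 : 1 < arity f).
Variables (phi psi : formula L).
Hypotheses (phi0 : forall z, occurs z phi -> z = 0)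
           (psi0 : forall z, occurs z psi -> z = 0).
Hypothesis phi_psi : logically_equivalent l phi psi.
Hypothesis phi_psi_neq :
  forall r : formula L, subst (fun=> r) phi <> subst (fun=> r) psi.

Let N := maxn (depth phi) (depth psi).

(** The two arguments of a redex over [r] have depths [N + 1 + depth r] and [2N + 2 + depth r]; this
    gap, larger than [N], drives the non-overlap proofs. *)
Definition wrap (u r : formula L) : formula L :=
  bin f (bin f u (tower f N r)) (tower f (N + N).+2 r).

Definition eps : formula L := wrap phi (Var 0).
Definition delta : formula L := wrap psi (Var 0).

Lemma occurs_wrap u z :
  occurs z (wrap u (Var 0)) -> (occurs z u -> z = 0) -> z = 0.
Proof. by move=> /occurs_bin[/occurs_bin[uz /(_ uz)|/occurs_tower]|/occurs_tower]. Qed.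

Lemma wrap_inj u r u' r' : wrap u r = wrap u' r' -> u = u' /\ r = r'.
Proof.
by move=> /(bin_inj f2)[/(bin_inj f2)[-> _] /(tower_inj f2)].
Qed.

Notation inst r u := (subst (fun=> r) u).

Definition redex r : formula L := wrap (inst r psi) r.
Definition reduct r : formula L := wrap (inst r phi) r.

Lemma redex_inj r r' : redex r = redex r' -> r = r'.
Proof. by case/wrap_inj. Qed.

(** Padding of fixed height forces [r = r'], leaving instances of [phi] and [psi] at the same
    formula. *)
Lemma reduct_redex r r' : reduct r <> redex r'.
Proof. by move=> /wrap_inj[E rr]; subst r'; apply: phi_psi_neq E. Qed.

Lemma bin_equiv u u' w : logically_equivalent l u u' ->
  logically_equivalent l (bin f u w) (bin f u' w).
Proof.
move=> H; apply: logically_equivalent_op => i; case: ifP => // _.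
exact: logically_equivalent_refl.
Qed.

Lemma reduct_equiv_redex r : logically_equivalent l (reduct r) (redex r).
Proof. exact/bin_equiv/bin_equiv/logically_equivalent_subst. Qed.

Lemma depth_inst r (u : formula L) : depth (inst r u) <= depth u + depth r.
Proof. exact: depth_subst_le. Qed.

Lemma depth_inst_dich r (u : formula L) :
  depth r <= depth (inst r u) \/ depth (inst r u) = depth u.
Proof.
have [[x xu]|ncl] := pselect (exists x, occurs x u).
  by left; exact: (depth_subst_occurs (fun=> r) xu).
by right; rewrite subst_closed // => x xu; apply: ncl; exists x.
Qed.

(* Formulas whose instances contain no redex, except inside the substituted
   formula. *)
Inductive inert : formula L -> Prop :=
| inert_Var x : inert (Var x)
| inert_App g a : (forall r r', inst r (App g a) <> redex r') ->
    (forall i, inert (a i)) -> inert (App g a).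

Lemma inert_bin u v : (forall r r', inst r (bin f u v) <> redex r') ->
  inert u -> inert v -> inert (bin f u v).
Proof. by move=> H iu iv; apply: inert_App => // i; case: ifP. Qed.

Lemma depth_redex_args r :
  depth (bin f (inst r psi) (tower f N r)) = (N + depth r).+1.
Proof.
rewrite depth_bin // depth_tower //; have := depth_inst r psi.
rewrite /N; lia.
Qed.

(** Were an instance over [r] a redex over [r'], its first argument would bound [depth r] by
    [N + 1 + depth r'], while the second would force [depth r] above that. *)
Lemma inert_small u : depth u <= N -> inert u.
Proof.
elim: u => [x _|g a IH aN]; first exact: inert_Var.
apply: inert_App => [r r' E|i]; last first.
  by apply: IH; apply: leq_trans (ltnW (depth_arg a i)) aN.
have gf : g = f by move/(congr1 (@head L)): E => -[].
subst g; move/(@App_inj L f): E => E.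
have E1 : depth (inst r (a (Ordinal (ltnW f2)))) =
    depth (bin f (inst r' psi) (tower f N r')).
  exact: (congr1 (fun c => depth (c (Ordinal (ltnW f2)))) E).
have E2 : depth (inst r (a (Ordinal f2))) = depth (tower f (N + N).+2 r').
  exact: (congr1 (fun c => depth (c (Ordinal f2))) E).
rewrite depth_redex_args in E1; rewrite depth_tower // in E2.
have := depth_arg a (Ordinal (ltnW f2)); have := depth_arg a (Ordinal f2).
have := depth_inst r (a (Ordinal f2)).
have := depth_inst_dich r (a (Ordinal (ltnW f2))).
rewrite E1 E2; lia.
Qed.

Lemma inert_tower n : inert (tower f n (Var 0)).
Proof.
elim: n => [|n IH]; first exact: inert_Var.
rewrite towerS; apply: inert_bin => // r r'; rewrite subst_bin => /bin_inj[] // -> .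
move/(congr1 (@depth L)); rewrite depth_redex_args depth_tower //; lia.
Qed.

Lemma inert_inner u : depth u <= N -> inert (bin f u (tower f N (Var 0))).
Proof.
move=> uN; apply: inert_bin; [|exact: inert_small|exact: inert_tower].
move=> r r'; rewrite subst_bin subst_tower /= => /bin_inj[] //.
move=> /(congr1 (@depth L)); rewrite depth_redex_args => E1.
move=> /(congr1 (@depth L)); rewrite !depth_tower // => E2.
have := depth_inst_dich r u; lia.
Qed.

(** * The rewritten algebra of a set of formulas *)

Section Theory.
Variables (T : set (formula L)).

(** The choice of [r] is harmless: [redex_inj] makes it unique. *)
Definition rewrite_root (t : formula L) : formula L :=
  if pselect (exists r, T r /\ t = redex r) is left H
  then reduct (projT1 (cid H)) else t.

Lemma rewrite_root_redex r : T r -> rewrite_root (redex r) = reduct r.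
Proof.
move=> Tr; rewrite /rewrite_root; case: pselect => [H|[]]; last by exists r.
by case: (cid H) => r' [Tr' E] /=; rewrite (redex_inj E).
Qed.

Lemma rewrite_root_id t : (forall r, T r -> t <> redex r) -> rewrite_root t = t.
Proof.
move=> H; rewrite /rewrite_root; case: pselect => // K; exfalso.
by case: K => r [/H].
Qed.

Definition rewritten_algebra : algebra L :=
  @Algebra L (formula L) (inhabits (Var 0)) (fun g a => rewrite_root (App g a)).

Notation evalr := (@eval L rewritten_algebra).

(** Only results of operations are rewritten; redexes inside the assigned value [r] stay
    untouched. *)
Lemma evalr_inert u r : inert u -> evalr (fun=> r) u = inst r u.
Proof.
elim=> [//|g a H _ IH] /=.
rewrite (_ : (fun i => _) = (fun i => inst r (a i))); last exact: funext.
by apply: rewrite_root_id => r' _; exact: H.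
Qed.

Lemma evalr_bin v u w :
  evalr v (bin f u w) = rewrite_root (bin f (evalr v u) (evalr v w)).
Proof.
rewrite /bin /=; congr (rewrite_root (App f _)).
by apply: funext => i; case: ifP.
Qed.

Lemma evalr_wrap u r : depth u <= N ->
  evalr (fun=> r) (wrap u (Var 0)) = rewrite_root (wrap (inst r u) r).
Proof.
move=> uN; rewrite [LHS]evalr_bin evalr_inert; last exact: inert_inner.
rewrite evalr_inert; last exact: inert_tower.
by rewrite subst_bin !subst_tower.
Qed.

(** The left side is always [reduct r]; the right side is [redex r], rewritten to [reduct r] exactly
    when [r] is in [T]. *)
Lemma evalr_eps_delta r :
  evalr (fun=> r) eps = evalr (fun=> r) delta <-> T r.
Proof.
rewrite !evalr_wrap ?leq_maxl ?leq_maxr //.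
rewrite rewrite_root_id; last by move=> r' _; exact: reduct_redex.
split=> [|Tr]; last by rewrite [RHS]rewrite_root_redex.
move=> E; apply: contrapT => nT; apply: (@reduct_redex r r); rewrite [LHS]E.
by apply: rewrite_root_id => r' Tr' /redex_inj rr; subst r'.
Qed.

Lemma rewrite_root_equiv t : logically_equivalent l (rewrite_root t) t.
Proof.
rewrite /rewrite_root; case: pselect => [H|_]; last first.
  exact: logically_equivalent_refl.
by case: (cid H) => r [Tr E] /=; rewrite E; exact: reduct_equiv_redex.
Qed.

Lemma evalr_equiv v t : logically_equivalent l (evalr v t) (subst v t).
Proof.
elim: t => [x|g a IH] /=; first exact: logically_equivalent_refl.
apply: logically_equivalent_trans (rewrite_root_equiv _) _.
exact: logically_equivalent_op.
Qed.

Lemma satisfies_eps_delta (h : Fm L -> rewritten_algebra) u : is_hom h ->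
  satisfies h (eq_inst u (eps, delta)) <-> T (h u).
Proof.
move=> hh; rewrite -evalr_eps_delta /satisfies /= !(hom_eval hh (subst1 _ _ _)).
rewrite !eval_subst1 -(hom_eval hh).
rewrite !(@eval_ext L rewritten_algebra (upd _ 0 (h u)) (fun=> h u)) //.
  by move=> x /occurs_wrap/(_ (psi0 (z := x))) ->.
by move=> x /occurs_wrap/(_ (phi0 (z := x))) ->.
Qed.

End Theory.

(** Values in [rewritten_algebra T] are logically equivalent to substitution instances, which a
    theory cannot tell apart. For completeness, [T] is [Th G] and each variable denotes itself. *)
Lemma rewritten_semantics : has_algebraic_semantics l.
Proof.
exists [set (eps, delta)].
exists (fun A => exists2 T, theory l T & A = rewritten_algebra T).
split=> [_ -> z [] /occurs_wrap|G chi]; [by apply; apply: phi0|by apply; apply: psi0|].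
split=> [Gchi _ -> _ [T TT ->] h hh hG|H].
  apply/satisfies_eps_delta => //.
  have E t := theory_equiv TT (@evalr_equiv T (h \o Var) t).
  have E' t := theory_equiv TT
    (logically_equivalent_sym (@evalr_equiv T (h \o Var) t)).
  rewrite (hom_eval hh); apply/E'/TT.
  apply: entails_trans (entails_inst (h \o Var) Gchi) => _ [g Gg <-].
  apply: entails_refl; apply: E; rewrite -(hom_eval hh).
  apply/(satisfies_eps_delta g hh); apply: hG.
  by exists g => //; exists (eps, delta).
have TT := @theory_Th L l G.
have E t := @evalr_equiv (Th l G) Var t.
pose h : Fm L -> rewritten_algebra (Th l G) :=
  eval (Var : nat -> rewritten_algebra _).
have hh : is_hom h by exact: eval_hom.
have : satisfies h (eq_inst chi (eps, delta)).
  apply: H => //; first by exists (Th l G).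
  move=> _ [g Gg [_ -> <-]]; apply/(satisfies_eps_delta g hh).
  apply: (theory_equiv TT (logically_equivalent_sym (E g))).
  by rewrite eval_Var; exact: entails_refl.
move/(satisfies_eps_delta _ hh)/(theory_equiv TT (E chi)).
by rewrite eval_Var.
Qed.

End RewrittenAlgebra.

Lemma equiv_algebraic_semantics (L : language) (l : logic L) (f : symbol L)
    (phi psi : formula L) :
  1 < arity f -> phi <> psi -> logically_equivalent l phi psi ->
  has_algebraic_semantics l.
Proof.
move=> f2 ne H; have [s [s0 sne]] := one_variable_instance f2 ne.
apply: (@rewritten_semantics L l f f2 (subst s phi) (subst s psi)) => //.
- by move=> z /occurs_subst[x _ /s0].
- by move=> z /occurs_subst[x _ /s0].
exact: logically_equivalent_subst.
Qed.

Theorem theorem9p3 (L : language) (l : logic L)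
    (l_nontrivial : nontrivial l) (l_protoalgebraic : protoalgebraic l) :
  [<-> has_algebraic_semantics l;
       exists phi psi : formula L, phi <> psi /\ logically_equivalent l phi psi;
       exists e : equation L,
         nontrivial_eq e /\ (forall A : algebra L, Alg l A -> validates A e);
       exists M : matrix L -> Prop, matrix_semantics l M /\
         exists e : equation L, nontrivial_eq e /\
           (forall m : matrix L, M m -> validates (matrix_alg m) e);
       ~ isomorphic (FmLT l) (Fm L)].
Proof.
tfae.
- exact: algebraic_semantics_equiv.
- by move=> [phi [psi [ne H]]]; exists (phi, psi); split=> //; exact: Alg_validates.
- move=> [e [ne H]]; eexists; split; first exact: FmLT_semantics.
  by exists e; split=> // m [mE _]; apply: H; rewrite mE; exact: Alg_FmLT.
- move=> [M [MS [[phi psi] [ne H]]]]; apply: (FmLT_not_isomorphic ne).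
  exact: matrix_semantics_equiv MS H.
(* Without an algebraic semantics distinct formulas are never equivalent, so the classes are
   singletons and choosing representatives is an isomorphism. *)
move=> niso; have [f f2] := protoalgebraic_arity l_nontrivial l_protoalgebraic.
apply: contrapT => nsem; apply: niso; apply: FmLT_isomorphic => phi psi H.
apply: contrapT => ne; apply: nsem; exact: equiv_algebraic_semantics f2 ne H.
Qed.
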